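(* Let $\Lambda=(W_j,\Lambda_j,v_j)_{j\in\mathbb{J}}$, where each $W_j$ is a closed subspace of $H$, $\Lambda_j\in\mathcal{B}(H,H_j)$ and $v_j>0$. Then $\Lambda$ is a g-fusion frame sequence if and only if $f\mapsto\{v_j\Lambda_j\pi_{W_j}f\}_{j\in\mathbb{J}}$ defines a map from $H$ onto a closed subspace of $\mathscr{H}_2$ (i.e. $\{v_j\Lambda_j\pi_{W_j}f\}_{j\in\mathbb{J}}\in\mathscr{H}_2$ for every $f\in H$, and the range of this map is closed in $\mathscr{H}_2$).
   Context: $H$ is a separable Hilbert space, $\mathbb{J}\subseteq\mathbb{Z}$, and $\{H_j\}_{j\in\mathbb{J}}$ is a family of Hilbert spaces. $\mathcal{B}(H,H_j)$ is the set of bounded linear operators from $H$ to $H_j$, and $\pi_V$ is the orthogonal projection of $H$ onto a closed subspace $V$. $\mathscr{H}_2=\{\{f_j\}_{j\in\mathbb{J}}: f_j\in H_j,\ \sum_{j\in\mathbb{J}}\|f_j\|^2<\infty\}$ is the Hilbert space with inner product $\langle\{f_j\},\{g_j\}\rangle=\sum_j\langle f_j,g_j\rangle$. Write $M=\overline{\mathrm{span}}\{\pi_{W_j}\Lambda_j^*H_j\}_{j\in\mathbb{J}}$, the closed linear span in $H$ of all the subspaces $\pi_{W_j}\Lambda_j^*(H_j)$. $\Lambda$ is a g-fusion frame sequence if it is a g-fusion frame for $M$, i.e. there exist $0<A\le B<\infty$ such that $A\|f\|^2\le\sum_{j\in\mathbb{J}}v_j^2\|\Lambda_j\pi_{W_j}f\|^2\le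 B\|f\|^2$ for all $f\in M$. *)

(* Defs.v *)
From HB Require Import structures.
From mathcomp Require Import all_boot all_order all_algebra sesquilinear.
From mathcomp Require Import complex ring.
From mathcomp Require Import mathcomp_extra boolp classical_sets functions.
From mathcomp Require Import cardinality fsbigop reals ereal topology tvs.
From mathcomp Require Import normedtype sequences esum.

Set Implicit Arguments.
Unset Strict Implicit.
Unset Printing Implicit Defensive.
Import Order.TTheory GRing.Theory Num.Theory.
Import numFieldNormedType.Exports.

Local Open Scope classical_set_scope.
Local Open Scope ring_scope.

(* "Hilbert space" means real or complex Hilbert space: the choice of the
   scalar field is a parameter of everything below. *)
Variant scalar_kind := RealScalars | ComplexScalars.

Definition scalar (R : realType) (k : scalar_kind) : numFieldType :=
  match k with RealScalars => R | ComplexScalars => R[i] end.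

Section Scalars.
Context {R : realType} {k : scalar_kind}.

Definition conj_scalar : scalar R k -> scalar R k :=
  match k return scalar R k -> scalar R k with
  | RealScalars => idfun | ComplexScalars => @conjc R
  end.

Definition re_scalar : scalar R k -> R :=
  match k return scalar R k -> R with
  | RealScalars => idfun | ComplexScalars => @complex.Re R
  end.

Definition of_real : R -> scalar R k :=
  match k return R -> scalar R k with
  | RealScalars => idfun | ComplexScalars => fun x => x%:C%C
  end.

Lemma of_realD x y : of_real (x + y) = of_real x + of_real y.
Proof. by rewrite /of_real; case: k => //; rewrite rmorphD. Qed.

Lemma of_realM x y : of_real (x * y) = of_real x * of_real y.
Proof. by rewrite /of_real; case: k => //; rewrite rmorphM. Qed.

Lemma of_real0 : of_real 0 = 0.
Proof. by rewrite /of_real; case: k. Qed.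

Lemma ler_of_real x y : (of_real x <= of_real y) = (x <= y).
Proof. by rewrite /of_real; case: k => //; rewrite lecR. Qed.

Lemma of_realK x : re_scalar (of_real x) = x.
Proof. by rewrite /of_real /re_scalar; case: k. Qed.

Lemma re_scalarK (z : scalar R k) : 0 <= z -> of_real (re_scalar z) = z.
Proof.
rewrite /of_real /re_scalar; case: k z => //= z /ger0_real.
exact: RRe_real.
Qed.

End Scalars.

HB.mixin Record isHilbert (R : realType) (k : scalar_kind) H
    & CompleteNormedModule (scalar R k) H := {
  inner : {dot H for @conj_scalar R k} ;
  normr_inner : forall x : H, `|x| ^+ 2 = inner x x
}.

#[short(type="hilbertType")]
HB.structure Definition Hilbert (R : realType) (k : scalar_kind) :=
  {H of CompleteNormedModule (scalar R k) H & isHilbert R k H}.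

(* The norm of a normed module over [scalar R k] takes its values in
   [scalar R k]; they are nonnegative, hence real. *)
Definition rnorm (R : realType) (k : scalar_kind)
  (V : normedModType (scalar R k)) (x : V) : R := re_scalar `|x|.

Section RNorm.
Context {R : realType} {k : scalar_kind} {V : normedModType (scalar R k)}.
Implicit Types x y : V.

Lemma rnormE x : of_real (rnorm x) = `|x|.
Proof. exact/re_scalarK/normr_ge0. Qed.

Lemma rnorm_ge0 x : 0 <= rnorm x.
Proof. by rewrite -(@ler_of_real _ k) of_real0 rnormE. Qed.

Lemma rnormD x y : rnorm (x + y) <= rnorm x + rnorm y.
Proof. by rewrite -(@ler_of_real _ k) of_realD !rnormE ler_normD. Qed.

Lemma rnormZ a x : rnorm (a *: x) = re_scalar `|a| * rnorm x.
Proof.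
rewrite -[LHS](@of_realK _ k) -[RHS](@of_realK _ k); congr re_scalar.
by rewrite rnormE normrZ of_realM rnormE re_scalarK.
Qed.

Lemma rnorm0_eq0 x : rnorm x = 0 -> x = 0.
Proof.
by move=> /(congr1 (@of_real R k)); rewrite rnormE of_real0 => /normr0_eq0.
Qed.

Lemma rnorm0 : rnorm (0 : V) = 0.
Proof. by rewrite -[LHS](@of_realK _ k) rnormE normr0 -of_real0 of_realK. Qed.

End RNorm.

Lemma esum_scale (R : realType) (I : choiceType) (D : set I) (c : R)
    (a : I -> R) : 0 <= c -> (forall i, 0 <= a i) ->
  (\esum_(i in D) (c * a i)%:E = c%:E * \esum_(i in D) (a i)%:E)%E.
Proof.
move=> c0 a0; rewrite /esum -ereal_supZl//; last first.
  apply/set0P; exists 0%E; exists set0; first exact: fsets_set0.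
  by rewrite fsbig_set0.
congr ereal_sup; rewrite image_comp; apply: eq_imagel => A [finA _] /=.
rewrite ge0_mule_fsumr => [|i]; last by rewrite lee_fin.
by apply: eq_fsbigr => i _; rewrite EFinM.
Qed.

Section DirectSum.
Context {R : realType} {k : scalar_kind} {I : choiceType}.
Variable E : I -> hilbertType R k.
Implicit Types f g : forall i, E i.

Definition sum_sqr_norm f : \bar R :=
  (\esum_(i in [set: I]) (rnorm (f i) ^+ 2)%:E)%E.

Definition square_summable f : Prop := (sum_sqr_norm f < +oo)%E.

Lemma sum_sqr_norm_ge0 f : (0 <= sum_sqr_norm f)%E.
Proof. by apply: esum_ge0 => i _; rewrite lee_fin sqr_ge0. Qed.

Lemma sum_sqr_normZ a f :
  sum_sqr_norm (fun i => a *: f i) =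
  ((re_scalar `|a| ^+ 2)%:E * sum_sqr_norm f)%E.
Proof.
rewrite /sum_sqr_norm -esum_scale ?sqr_ge0// => [|i]; last exact: sqr_ge0.
by apply: eq_esum => i _; rewrite rnormZ exprMn.
Qed.

(* The choice t = |g| / |f| gives Minkowski's inequality. *)
Lemma sum_sqr_normD t f g : 0 < t ->
  (sum_sqr_norm (fun i => f i + g i)%R <=
   (1 + t)%:E * sum_sqr_norm f + (1 + t^-1)%:E * sum_sqr_norm g)%E.
Proof.
move=> t0.
have t1 : 0 <= 1 + t by rewrite addr_ge0 ?ltW.
have tV1 : 0 <= 1 + t^-1 by rewrite addr_ge0 ?invr_ge0 ?ltW.
rewrite -!esum_scale//; [|by move=> i; exact: sqr_ge0..].
rewrite -esumD; [|by move=> i _; rewrite lee_fin mulr_ge0 ?sqr_ge0..].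
apply: le_esum => i _; rewrite -EFinD lee_fin.
have := rnormD (f i) (g i); have := rnorm_ge0 (f i + g i).
move: (rnorm (f i + g i)) (rnorm (f i)) (rnorm (g i)) => c a b c0 cab.
apply: (@le_trans _ _ ((a + b) ^+ 2)).
  by rewrite ler_sqr ?nnegrE// (le_trans c0).
rewrite -subr_ge0 (_ : _ - _ = t * (a - t^-1 * b) ^+ 2).
  by rewrite mulr_ge0 ?sqr_ge0// ltW.
by field; rewrite gt_eqF.
Qed.

Lemma sum_sqr_norm_eq0 f : sum_sqr_norm f = 0%E -> forall i, f i = 0.
Proof.
move=> f0 i; apply/rnorm0_eq0/eqP; rewrite -sqrf_eq0 eq_le sqr_ge0 andbT.
rewrite -lee_fin; apply: (@le_trans _ _ (sum_sqr_norm f)); last by rewrite f0.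
apply: esum_ge; exists [set i]; last by rewrite fsbig_set1.
by split; first exact: finite_set1.
Qed.

Lemma sum_sqr_norm0 : sum_sqr_norm (fun=> 0) = 0%E.
Proof. by apply: esum1 => i _; rewrite rnorm0 expr0n. Qed.

Lemma square_summable0 : square_summable (fun=> 0).
Proof. by rewrite /square_summable sum_sqr_norm0 ltry. Qed.

Lemma square_summableD f g : square_summable f -> square_summable g ->
  square_summable (fun i => f i + g i).
Proof.
move=> ff gf; apply: le_lt_trans (sum_sqr_normD _ _ ltr01) _.
by rewrite lte_add_pinfty// lte_mul_pinfty// lee_fin addr_ge0 ?invr_ge0.
Qed.

Lemma square_summableZ a f : square_summable f ->
  square_summable (fun i => a *: f i).
Proof.
move=> ff; rewrite /square_summable sum_sqr_normZ.
by rewrite lte_mul_pinfty// lee_fin sqr_ge0.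
Qed.

Record l2sum := L2sum {
  l2fun :> forall i, E i ;
  l2funP : square_summable l2fun
}.

Lemma l2sumP (u v : l2sum) : (forall i, u i = v i) -> u = v.
Proof.
case: u v => [f Pf] [g Pg] /= fg.
have {fg}fg : f = g by apply: functional_extensionality_dep.
by case: _ / fg Pg => Pg; congr L2sum; exact: Prop_irrelevance.
Qed.

HB.instance Definition _ := gen_eqMixin l2sum.
HB.instance Definition _ := gen_choiceMixin l2sum.

Implicit Types u v w : l2sum.

Definition l2_zero := L2sum square_summable0.
Definition l2_add u v := L2sum (square_summableD (l2funP u) (l2funP v)).
Definition l2_scale a u := L2sum (square_summableZ a (l2funP u)).
Definition l2_opp u := l2_scale (-1) u.

Let l2_addA : associative l2_add.
Proof. by move=> u v w; apply: l2sumP => i; exact: addrA. Qed.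
Let l2_addC : commutative l2_add.
Proof. by move=> u v; apply: l2sumP => i; exact: addrC. Qed.
Let l2_add0 : left_id l2_zero l2_add.
Proof. by move=> u; apply: l2sumP => i; exact: add0r. Qed.
Let l2_addN : left_inverse l2_zero l2_opp l2_add.
Proof. by move=> u; apply: l2sumP => i /=; rewrite scaleN1r addNr. Qed.

HB.instance Definition _ :=
  GRing.isZmodule.Build l2sum l2_addA l2_addC l2_add0 l2_addN.

Let l2_scaleA a b u : l2_scale a (l2_scale b u) = l2_scale (a * b) u.
Proof. by apply: l2sumP => i; exact: scalerA. Qed.
Let l2_scale1 : left_id 1 l2_scale.
Proof. by move=> u; apply: l2sumP => i; exact: scale1r. Qed.
Let l2_scaleDr : right_distributive l2_scale +%R.
Proof. by move=> a u v; apply: l2sumP => i; exact: scalerDr. Qed.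
Let l2_scaleDl u : {morph l2_scale^~ u : a b / a + b}.
Proof. by move=> a b; apply: l2sumP => i; exact: scalerDl. Qed.

HB.instance Definition _ := GRing.Zmodule_isLmodule.Build (scalar R k) l2sum
  l2_scaleA l2_scale1 l2_scaleDr l2_scaleDl.

(* The norm of the inner product sum_i <f_i, g_i>. *)
Definition l2_rnorm u : R := Num.sqrt (fine (sum_sqr_norm u)).

Lemma l2_rnorm_sqr u : ((l2_rnorm u ^+ 2)%:E = sum_sqr_norm u)%E.
Proof.
rewrite sqr_sqrtr ?fine_ge0 ?sum_sqr_norm_ge0// fineK//.
by rewrite ge0_fin_numE ?sum_sqr_norm_ge0//; exact: l2funP.
Qed.

Lemma l2_rnorm_ge0 u : 0 <= l2_rnorm u. Proof. exact: sqrtr_ge0. Qed.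

Lemma l2_rnorm0_eq0 u : l2_rnorm u = 0 -> u = 0.
Proof.
move=> u0; apply: l2sumP; apply: sum_sqr_norm_eq0.
by rewrite -l2_rnorm_sqr u0 expr0n.
Qed.

Lemma l2_rnormD u v : l2_rnorm (u + v) <= l2_rnorm u + l2_rnorm v.
Proof.
have [u0|u0] := eqVneq (l2_rnorm u) 0.
  by rewrite (l2_rnorm0_eq0 u0) add0r lerDr l2_rnorm_ge0.
have [v0|v0] := eqVneq (l2_rnorm v) 0.
  by rewrite (l2_rnorm0_eq0 v0) addr0 lerDl l2_rnorm_ge0.
have {u0}u0 : 0 < l2_rnorm u by rewrite lt_neqAle eq_sym u0 l2_rnorm_ge0.
have {v0}v0 : 0 < l2_rnorm v by rewrite lt_neqAle eq_sym v0 l2_rnorm_ge0.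
rewrite -ler_sqr ?nnegrE ?addr_ge0 ?l2_rnorm_ge0//.
have := sum_sqr_normD u v (divr_gt0 v0 u0).
rewrite -!l2_rnorm_sqr -!EFinM -EFinD -(l2_rnorm_sqr (u + v)) lee_fin.
move=> le_uv; apply: le_trans le_uv _; rewrite le_eqVlt; apply/orP; left.
by apply/eqP; field; rewrite !gt_eqF.
Qed.

Lemma l2_rnormZ a u : l2_rnorm (a *: u) = re_scalar `|a| * l2_rnorm u.
Proof.
have a0 : 0 <= re_scalar `|a| by rewrite -(@ler_of_real _ k) of_real0 re_scalarK.
have Z : sum_sqr_norm (a *: u) = ((re_scalar `|a| ^+ 2)%:E * sum_sqr_norm u)%E.
  exact: sum_sqr_normZ.
by rewrite {1}/l2_rnorm Z -l2_rnorm_sqr /= -exprMn sqrtr_sqr ger0_norm ?mulr_ge0 ?l2_rnorm_ge0.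
Qed.

Let norm u : scalar R k := of_real (l2_rnorm u).

Let ler_normD u v : norm (u + v) <= norm u + norm v.
Proof. by rewrite -of_realD ler_of_real l2_rnormD. Qed.

Let normrZ a u : norm (a *: u) = `|a| * norm u.
Proof. by rewrite /norm l2_rnormZ of_realM re_scalarK. Qed.

Let normr0_eq0 u : norm u = 0 -> u = 0.
Proof.
by move=> /(congr1 re_scalar); rewrite -of_real0 !of_realK => /l2_rnorm0_eq0.
Qed.

HB.instance Definition _ := Lmodule_isNormed.Build (scalar R k) l2sum
  ler_normD normrZ normr0_eq0.

End DirectSum.

Lemma l2_normE (R : realType) (k : scalar_kind) (I : choiceType)
    (E : I -> hilbertType R k) (u : l2sum E) :
  `|u| = of_real (Num.sqrt (fine (sum_sqr_norm u))).
Proof. by []. Qed.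

Definition separable_space (T : topologicalType) : Prop :=
  exists2 D : set T, countable D & dense D.

Definition linear_subspace (K : numFieldType) (V : lmodType K) (S : set V) :
  Prop := S 0 /\ forall (a : K) x y, S x -> S y -> S (a *: x + y).

Definition closed_subspace (K : numFieldType) (V : normedModType K)
  (S : set V) : Prop := linear_subspace S /\ closed S.

Definition closed_span (K : numFieldType) (V : normedModType K) (S : set V) :
  set V := closure (smallest (@linear_subspace K V) S).

Section Operators.
Context {R : realType} {k : scalar_kind}.

(* The default value 0 is not used when S is a closed subspace. *)
Definition orth_proj (H : hilbertType R k) (S : set H) (f : H) : H :=
  xget 0 [set p | S p /\ forall w, S w -> inner (f - p) w = 0].

(* The default value 0 is not used when T is linear and bounded. *)
Definition adjoint (H G : hilbertType R k) (T : H -> G) (g : G) : H :=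
  xget 0 [set h | forall f, inner (T f) g = inner f h].

End Operators.

Section GFusion.
Context {R : realType} {k : scalar_kind} {H : hilbertType R k}.
Context {I : choiceType} {E : I -> hilbertType R k}.
Variables (W : I -> set H) (Lambda : forall i, {linear H -> E i}) (v : I -> R).

Definition analysis (f : H) : forall i, E i :=
  fun i => of_real (v i) *: Lambda i (orth_proj (W i) f).

Definition gfusion_span : set H :=
  closed_span
    (\bigcup_i range (fun g : E i => orth_proj (W i) (adjoint (Lambda i) g))).

Definition gfusion_frame_sequence : Prop :=
  exists A B : R, [/\ 0 < A, A <= B &
    forall f, gfusion_span f ->
      ((A * rnorm f ^+ 2)%:E <=
       \esum_(i in [set: I])
          (v i ^+ 2 * rnorm (Lambda i (orth_proj (W i) f)) ^+ 2)%:E <=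
       (B * rnorm f ^+ 2)%:E)%E].

Definition analysis_range : set (l2sum E) :=
  [set u | exists f, l2fun u = analysis f].

End GFusion.

(* Main.v *)
From mathcomp Require Import all_boot all_order all_algebra.
From mathcomp Require Import finmap complex ring lra.
From mathcomp Require Import boolp classical_sets.
From mathcomp Require Import cardinality fsbigop reals ereal topology.
From mathcomp Require Import normedtype sequences esum.
Require Import Defs.

(** Write [T f] for the family of all [v j *: Lambda j (orth_proj (W j) f)], and
    [M] for the closed span of the ranges of the adjoints of the coordinates of
    [T], with orthogonal projection [proj_M].  The orthogonal complement of [M]
    is the kernel of [T], so [T f = T (proj_M f)] for every [f]
    ([analysis_orth_proj]): all that happens takes place on [M].

    A frame sequence satisfies [A * |f|^2 <= |T f|^2 <= B * |f|^2] on [M].  The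
    upper bound makes [T f] square summable for [f] in [M], hence for all [f].
    The lower bound makes the range closed: if [T (f n)] converges with [f n] in
    [M], then [f n] is a Cauchy sequence ([frame_closed_range]).

    Conversely, suppose that [T f] is always square summable and that the range
    of [T] is closed in the Hilbert sum.  Both frame bounds are instances of one
    principle, proved by Baire's argument ([lsc_seminorm_dominated]): if a vector
    space is complete for a seminorm [N], every seminorm [q] that is lower
    semicontinuous for [N] satisfies [q <= C * N].
    - For the upper bound, [N f = |f|] and [q f = |T f|]; semicontinuity is
      Fatou's lemma for sums.
    - For the lower bound, [N f = |T f|] and [q f = |proj_M f|].  Completeness of
      [N] follows from the closed range and from the completeness of the Hilbert
      sum ([l2sum_complete]).  Semicontinuity holds because [|proj_M f|] is
      determined by the inner products of [f] with the span of the adjoint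
      ranges, each of which is continuous for [N]. *)

Set Implicit Arguments.
Unset Strict Implicit.
Unset Printing Implicit Defensive.
Import Order.TTheory GRing.Theory Num.Theory.
Import numFieldNormedType.Exports.
Local Open Scope classical_set_scope.
Local Open Scope ring_scope.

(** * Real and complex scalars, the real part of the inner product *)

Section RealScalars.
Context {R : realType} {k : scalar_kind}.
Implicit Types (a b : scalar R k) (x : R).

Lemma of_real1 : of_real 1 = 1 :> scalar R k.
Proof. by rewrite /of_real; case: k. Qed.

Lemma re_scalarD a b : re_scalar (a + b) = re_scalar a + re_scalar b.
Proof. by rewrite /re_scalar; case: k a b => //= a b; rewrite raddfD. Qed.

Lemma re_scalarN a : re_scalar (- a) = - re_scalar a.
Proof. by rewrite /re_scalar; case: k a => //= a; rewrite raddfN. Qed.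

Lemma re_scalarMr x a : re_scalar (of_real x * a) = x * re_scalar a.
Proof.
rewrite /re_scalar /of_real; case: k a => //= -[c d] /=.
by rewrite /= mul0r subr0.
Qed.

Lemma re_conj a : re_scalar (conj_scalar a) = re_scalar a.
Proof. by rewrite /re_scalar /conj_scalar; case: k a => //= -[]. Qed.

Lemma conj_scalarK : involutive (@conj_scalar R k).
Proof. by rewrite /conj_scalar; case: k => //= a; rewrite conjcK. Qed.

Lemma conj_of_real x : conj_scalar (of_real x : scalar R k) = of_real x.
Proof. by rewrite /of_real /conj_scalar; case: k => //=; rewrite /conjc /= oppr0. Qed.

Lemma mul_conj_scalar a : conj_scalar a * a = `|a| ^+ 2.
Proof.
rewrite /conj_scalar; case: k a => /= a.
  by rewrite -expr2 real_normK ?num_real.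
by rewrite mulrC -sqr_normc.
Qed.

(** Recovers the vanishing of a complex number from the vanishing of a real
    part, once it may be multiplied by its own conjugate. *)
Lemma re_scalar_eq0 a : re_scalar (conj_scalar a * a) = 0 -> a = 0.
Proof.
rewrite mul_conj_scalar => /(congr1 (@of_real R k)).
rewrite re_scalarK ?exprn_ge0// of_real0.
by move=> /eqP; rewrite sqrf_eq0 normr_eq0 => /eqP.
Qed.

Lemma norm_of_real x : re_scalar `|of_real x : scalar R k| = `|x|.
Proof.
have [x0|x0] := leP 0 x.
  by rewrite (ger0_norm x0) ger0_norm ?of_realK// -(@of_real0 R k) ler_of_real.
rewrite (ltr0_norm x0) ler0_norm ?re_scalarN ?of_realK//.
by rewrite -(@of_real0 R k) ler_of_real ltW.
Qed.

End RealScalars.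

Section InnerProduct.
Context {R : realType} {k : scalar_kind} {H : hilbertType R k}.
Implicit Types (x y z : H) (a : scalar R k).

Lemma innerC x y : inner x y = conj_scalar (inner y x).
Proof. by rewrite (hermitian_subproof (s := inner)) expr0 mul1r. Qed.

Lemma innerDl x y z : inner (x + y) z = inner x z + inner y z.
Proof. exact: linearDl. Qed.

Lemma innerZl a x y : inner (a *: x) y = a * inner x y.
Proof. exact: linearZl_LR. Qed.

Lemma innerZr a x y : inner x (a *: y) = conj_scalar a * inner x y.
Proof. exact: linearZr_LR. Qed.

(** The inner product of the underlying real Hilbert space.  Estimates are made
    with this real number, so that the two choices of scalars are treated
    alike; [inner_eq0] below goes back to the original inner product. *)
Definition re_inner x y : R := re_scalar (inner x y).

Lemma re_innerC x y : re_inner x y = re_inner y x.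
Proof. by rewrite /re_inner innerC re_conj. Qed.

Lemma re_innerDl x y z : re_inner (x + y) z = re_inner x z + re_inner y z.
Proof. by rewrite /re_inner innerDl re_scalarD. Qed.

Lemma re_innerZl (c : R) x y :
  re_inner (of_real c *: x) y = c * re_inner x y.
Proof. by rewrite /re_inner innerZl re_scalarMr. Qed.

Lemma re_inner_rnorm x : re_inner x x = rnorm x ^+ 2.
Proof.
rewrite /re_inner -normr_inner -rnormE.
by rewrite expr2 -of_realM of_realK -expr2.
Qed.

End InnerProduct.

(** * Null sequences *)

Section NullSequences.
Context {R : realType}.
Implicit Types (w : nat -> R) (x y K e : R).

Lemma null_seqP w : w @ \oo --> 0 <->
  forall e, 0 < e -> exists n0, forall n, (n0 <= n)%N -> `|w n| <= e.
Proof.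
split=> [/cvgr0Pnorm_le w0 e e0|w0].
  by have [n0 _ wn0] := w0 e e0; exists n0 => n /wn0.
apply/cvgr0Pnorm_le => e /w0[n0 wn0].
by exists n0 => // n /= /wn0.
Qed.

Lemma le_null w w' K : w' @ \oo --> 0 ->
  (forall n, 0 <= w n <= K * w' n) -> w @ \oo --> 0.
Proof.
move=> w'0 ww'; apply: (squeeze_cvgr _ (cvg_cst 0) (h := fun n => K * w' n)).
  by near=> n; exact: ww'.
by rewrite -[X in _ --> X](mulr0 K); apply: cvgMr.
Unshelve. all: by end_near. Qed.

(** Most passages to the limit below are this one: an inequality that holds up
    to a multiple of a null sequence holds exactly. *)
Lemma ler_null_perturb w x y K : w @ \oo --> 0 ->
  (forall n, x <= y + K * w n) -> x <= y.
Proof.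
move=> w0 xy; suff c : (fun n => y + K * w n) @ \oo --> y.
  by apply: (cvgr_to_ge c); near=> n; exact: xy.
rewrite -[X in _ --> X](addr0 y) -[X in _ + X](mulr0 K).
by apply: cvgD; [exact: cvg_cst | apply: cvgMr].
Unshelve. all: by end_near. Qed.

Lemma ex_nat_gt x : exists n, x < n%:R.
Proof. by exists (Num.truncn x).+1; exact: truncnS_gt. Qed.

End NullSequences.

(** * Lower semicontinuous seminorms on complete seminormed spaces *)

Section Seminorms.
Context {R : realType} {k : scalar_kind} {V : lmodType (scalar R k)}.
Implicit Types (N q : V -> R) (u : nat -> V).

Definition seminorm q : Prop :=
  (forall x y, q (x + y) <= q x + q y) /\
  (forall a x, q (a *: x) = re_scalar `|a| * q x).

Section Basics.
Variables (q : V -> R) (qP : seminorm q).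

Lemma seminormD x y : q (x + y) <= q x + q y. Proof. exact: qP.1. Qed.

Lemma seminormZ a x : q (a *: x) = re_scalar `|a| * q x. Proof. exact: qP.2. Qed.

Lemma seminorm_realZ c x : q (of_real c *: x) = `|c| * q x.
Proof. by rewrite seminormZ norm_of_real. Qed.

Lemma seminorm0 : q 0 = 0.
Proof.
by rewrite -(scale0r 0) -(@of_real0 R k) seminorm_realZ normr0 mul0r.
Qed.

Lemma seminormN x : q (- x) = q x.
Proof.
by rewrite -scaleN1r seminormZ normrN normr1 -of_real1 of_realK mul1r.
Qed.

Lemma seminormC x y : q (x - y) = q (y - x).
Proof. by rewrite -seminormN opprB. Qed.

Lemma seminorm_triangle x y z : q (x - z) <= q (x - y) + q (y - z).
Proof. by rewrite -{1}(subrK y x) -addrA seminormD. Qed.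

Lemma seminorm_ge0 x : 0 <= q x.
Proof.
have := seminormD x (- x); rewrite subrr seminorm0 seminormN -mulr2n.
by rewrite pmulrn_lge0.
Qed.

Lemma ler_seminorm_dist x y : `|q x - q y| <= q (x - y).
Proof.
have := seminormD (x - y) y; have := seminormD (y - x) x.
rewrite !subrK (seminormC y) ler_norml => h1 h2; lra.
Qed.

End Basics.

Definition seminorm_cvg N u x : Prop := (fun n => N (u n - x)) @ \oo --> (0 : R).

Definition seminorm_cauchy N u : Prop := forall e : R, 0 < e ->
  exists n0, forall m n, (n0 <= m)%N -> (n0 <= n)%N -> N (u m - u n) <= e.

Definition seminorm_complete N : Prop :=
  forall u, seminorm_cauchy N u -> exists x, seminorm_cvg N u x.

Definition seq_lower_semicontinuous N q : Prop := forall u x (c : R),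
  (forall n, q (u n) <= c) -> seminorm_cvg N u x -> q x <= c.

Lemma seminorm_cvg_norm N u x : seminorm N -> seminorm_cvg N u x ->
  (fun n => N (u n)) @ \oo --> N x.
Proof.
move=> NP /null_seqP ux; apply/cvgrPdist_le => e /ux[n0 n0P].
exists n0 => // n /= /n0P; apply: le_trans.
by rewrite distrC (le_trans (ler_seminorm_dist NP _ _)) ?ler_norm.
Qed.

(** The parallelogram law and the lower frame bound control squared distances,
    hence this form of the Cauchy criterion. *)
Lemma seminorm_cauchy_sqr N u w : w @ \oo --> (0 : R) ->
  (forall m n, N (u m - u n) ^+ 2 <= w m + w n) -> seminorm_cauchy N u.
Proof.
move=> /null_seqP w0 Nw e e0.
have [|n0 wn0] := w0 (e ^+ 2 / 2); first by rewrite divr_gt0 ?exprn_gt0.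
exists n0 => m n /wn0 wm /wn0 wn.
rewrite leNgt; apply/negP => eN.
have : e ^+ 2 < N (u m - u n) ^+ 2 by rewrite ltr_pXn2r ?nnegrE ?ltW// (lt_trans e0).
apply/negP; rewrite -leNgt (le_trans (Nw m n))//.
move: wm wn => /ler_normlW wm /ler_normlW wn; lra.
Qed.

Section Zabreiko.
Variables (N q : V -> R).
Hypotheses (NP : seminorm N) (qP : seminorm q).
Hypothesis Ncomplete : seminorm_complete N.
Hypothesis q_lsc : seq_lower_semicontinuous N q.

(** Otherwise points of [q <= c] would converge to [x] for [N], and
    semicontinuity would give [q x <= c]. *)
Lemma lsc_superlevel_ball x c r : c < q x -> 0 < r ->
  exists s, [/\ 0 < s, s <= r & forall y, N (y - x) <= s -> c < q y].
Proof.
move=> cqx r0; apply: contrapT => noball.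
have noball' n : exists y, N (y - x) <= Num.min r (harmonic n) /\ q y <= c.
  apply: contrapT => h; apply: noball; exists (Num.min r (harmonic n)).
  split=> [||y Ny]; first by rewrite lt_min r0 harmonic_gt0.
    by rewrite ge_min lexx.
  by rewrite ltNge; apply/negP => qy; apply: h; exists y.
have [y yP] := choice noball'.
have : q x <= c.
  apply: (@q_lsc y) => [n|]; first by have [] := yP n.
  apply: (@le_null _ _ harmonic 1 (@cvg_harmonic R)) => n.
  have [yn _] := yP n; rewrite seminorm_ge0// mul1r (le_trans yn)//.
  by rewrite ge_min lexx orbT.
by rewrite leNgt cqx.
Qed.

(** Baire's argument.  If [q] is unbounded on every ball, each ball contains a
    smaller one on which [q] exceeds [n].  Nesting such balls with radii at
    most [1 / n.+1] produces, by completeness, a common point, where [q] would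
    exceed every integer.  The argument is run on the seminorm itself because
    [N] is allowed to vanish on nonzero vectors. *)
Lemma lsc_bounded_on_ball : exists x (r c : R),
  0 < r /\ forall y, N (y - x) <= r -> q y <= c.
Proof.
apply: contrapT => unbounded.
have step (n : nat) (b : V * R) : exists b' : V * R, 0 < b.2 ->
    [/\ 0 < b'.2, b'.2 <= harmonic n,
        forall z, N (z - b'.1) <= b'.2 -> N (z - b.1) <= b.2 &
        forall z, N (z - b'.1) <= b'.2 -> n%:R < q z].
  case: b => x r /=; case: (ltP 0 r) => [r0|]; last by exists (x, r).
  have r20 : 0 < r / 2 by rewrite divr_gt0.
  have [y [yx ny]] : exists y, N (y - x) <= r / 2 /\ n%:R < q y.
    apply: contrapT => h; apply: unbounded; exists x, (r / 2), n%:R.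
    split=> // y yx; rewrite leNgt; apply/negP => ny; apply: h; exists y.
    by split.
  have [|s [s0 sr sq]] := @lsc_superlevel_ball y n%:R (Num.min (r / 2) (harmonic n)) ny.
    by rewrite lt_min r20 harmonic_gt0.
  move: sr; rewrite le_min => /andP[sr sn].
  exists (y, s) => /= _; split=> // z zy.
  by have := seminorm_triangle NP z y x; lra.
have [next nextP] := choice (fun nb : nat * (V * R) => step nb.1 nb.2).
(* The index of the sequence is also the level: q exceeds n on the ball n.+1. *)
pose b := fix b n := if n is n'.+1 then next (n', b n') else (0, 1).
have b0 n : 0 < (b n).2.
  by elim: n => [|n IH] /=; [exact: ltr01 | have [] := nextP (n, b n) IH].
have bP n := nextP (n, b n) (b0 n).
have nested n m z : N (z - (b (n + m)%N).1) <= (b (n + m)%N).2 ->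
    N (z - (b n).1) <= (b n).2.
  elim: m => [|m IH]; first by rewrite addn0.
  by rewrite addnS => zb; apply: IH; have [_ _ + _] := bP (n + m)%N; exact.
have bcenter n m : N ((b (n + m)%N).1 - (b n).1) <= (b n).2.
  by apply: (@nested n m); rewrite subrr seminorm0// ltW.
have [x bx] : exists x, seminorm_cvg N (fun n => (b n.+1).1) x.
  apply: Ncomplete => e e0.
  have e20 : 0 < e / 2 by rewrite divr_gt0.
  have [n0 n0P] := (null_seqP _).1 (@cvg_harmonic R) _ e20.
  have {n0P}n0P : (b n0.+1).2 <= e / 2.
    have [_ + _ _] := bP n0; move=> /le_trans; apply.
    by have /ler_normlW := n0P _ (leqnn n0).
  exists n0 => m n m0 n0'.
  have := bcenter n0.+1 (m - n0)%N; have := bcenter n0.+1 (n - n0)%N.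
  rewrite !addSn !subnKC// (seminormC NP (b n.+1).1) => hn hm.
  have := seminorm_triangle NP (b m.+1).1 (b n0.+1).1 (b n.+1).1; lra.
have xb n : N (x - (b n.+1).1) <= (b n.+1).2.
  apply: (@ler_null_perturb _ (fun m => N ((b (n + m).+1).1 - x)) _ _ 1).
    have /null_seqP bx' := bx; apply/null_seqP => e /bx'[n0 n0P].
    by exists n0 => m nm; apply: n0P; rewrite (leq_trans nm)// leq_addl.
  move=> m; have := bcenter n.+1 m; rewrite addSn mul1r.
  have := seminorm_triangle NP x (b (n + m).+1).1 (b n.+1).1.
  rewrite (seminormC NP x (b (n + m).+1).1); lra.
have [n nq] := ex_nat_gt (q x).
have [_ _ _ /(_ _ (xb n))] := bP n.
by rewrite ltNge ltW.
Qed.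

(** Zabreiko's form of the uniform boundedness principle.  A bound [c] on a ball
    of radius [r] around some [x0] gives, by subtracting [x0], the bound [2 * c]
    on the ball of radius [r] around the origin, and homogeneity does the rest. *)
Theorem lsc_seminorm_dominated : exists2 C, 0 < C & forall x, q x <= C * N x.
Proof.
have [x0 [r [c [r0 ballP]]]] := lsc_bounded_on_ball.
have scaled t x : 0 <= t -> t * N x <= r -> t * q x <= 2 * c.
  move=> t0 tx.
  have : q (x0 + of_real t *: x) <= c.
    by apply: ballP; rewrite addrAC subrr add0r seminorm_realZ// ger0_norm.
  have : q x0 <= c by apply: ballP; rewrite subrr seminorm0// ltW.
  have := seminorm_triangle qP (x0 + of_real t *: x) 0 x0.
  rewrite subr0 sub0r seminormN// addrAC subrr add0r seminorm_realZ// ger0_norm//.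
  lra.
have c0 : 0 <= c.
  by apply: le_trans (seminorm_ge0 qP x0) (ballP _ _); rewrite subrr seminorm0// ltW.
exists ((2 * c + 1) / r) => [|x]; first by rewrite divr_gt0//; lra.
have /orP[/eqP Nx|Nx] : (0 == N x) || (0 < N x).
  by rewrite -le_eqVlt; exact: seminorm_ge0.
  (* All multiples of x lie in the ball; the factor (2c + 1) / q x is the one
     that would take q beyond 2c. *)
  rewrite -Nx mulr0 leNgt; apply/negP => qx.
  have := scaled ((2 * c + 1) / q x) x.
  rewrite -Nx mulr0 (ltW r0) divfK ?gt_eqF// => /(_ _ isT).
  suff : 0 <= (2 * c + 1) / q x by move=> -> /(_ isT); lra.
  by apply: divr_ge0; [lra | exact: ltW].
have rN : 0 <= r / N x by rewrite divr_ge0 ?ltW.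
have := scaled (r / N x) x rN; rewrite divfK ?gt_eqF// => /(_ (lexx _)).
rewrite mulrAC ler_pdivrMr// => h.
rewrite mulrAC ler_pdivlMr// mulrC (le_trans h)// ler_wpM2r ?(ltW Nx)//; lra.
Qed.

End Zabreiko.
End Seminorms.

(** * Sequential description of the norm topology *)

Section NormTopology.
Context {R : realType} {k : scalar_kind}.

Lemma ltr_of_real (x y : R) : (of_real x < of_real y :> scalar R k) = (x < y).
Proof. by rewrite /of_real; case: k => //; rewrite ltcR. Qed.

Lemma rnorm_seminorm (V : normedModType (scalar R k)) : seminorm (@rnorm R k V).
Proof. by split; [exact: rnormD | exact: rnormZ]. Qed.

(** The radii of the library balls are scalars, possibly complex; the lemmas of
    this section replace them by real radii and neighbourhoods by sequences. *)
Lemma ball_rnorm (V : normedModType (scalar R k)) (x y : V) (e : R) :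
  ball x (of_real e) y <-> rnorm (y - x) < e.
Proof. by rewrite -ball_normE /= distrC -rnormE ltr_of_real. Qed.

Lemma nbhs_rnorm (V : normedModType (scalar R k)) (x : V) (B : set V) :
  nbhs x B -> exists2 e : R, 0 < e & forall y, rnorm (y - x) < e -> B y.
Proof.
move=> /nbhs_ballP[e /= e0 eB]; exists (re_scalar e) => [|y].
  by rewrite -(@ltr_of_real) of_real0 re_scalarK ?ltW.
by rewrite -ball_rnorm re_scalarK ?ltW// => /eB.
Qed.

Section Sequences.
Context {V : normedModType (scalar R k)}.
Implicit Types (S : set V) (u : nat -> V) (x : V).

Lemma closed_seminorm_cvg S u x : closed S -> (forall n, S (u n)) ->
  seminorm_cvg (@rnorm R k V) u x -> S x.
Proof.
move=> closedS Su /null_seqP ux; apply: closedS => B /nbhs_rnorm[e e0 eB].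
have [|n0 /(_ _ (leqnn _)) /ler_normlW n0e] := ux (e / 2); first exact: divr_gt0.
exists (u n0); split=> //; apply: eB; rewrite (le_lt_trans n0e)//.
by rewrite gtr_pMr// invf_lt1// ltr1n.
Qed.

Lemma closure_seminorm_cvg S x : closure S x ->
  exists2 u, (forall n, S (u n)) & seminorm_cvg (@rnorm R k V) u x.
Proof.
move=> clSx.
have /choice[u uP] n : exists y, S y /\ rnorm (y - x) < harmonic n.
  have [|y [Sy /ball_rnorm xy]] := clSx (ball x (of_real (harmonic n))).
    by apply: nbhsx_ballx; rewrite -of_real0 ltr_of_real harmonic_gt0.
  by exists y.
exists u => [n|]; first by have [] := uP n.
apply: (@le_null _ _ harmonic 1 (@cvg_harmonic R)) => n.
by rewrite rnorm_ge0 mul1r ltW//; have [] := uP n.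
Qed.

Lemma linear_subspaceZ S a x : linear_subspace S -> S x -> S (a *: x).
Proof. by move=> [S0 SD] Sx; rewrite -[_ *: _]addr0; exact: SD. Qed.

Lemma linear_subspaceD S x y : linear_subspace S -> S x -> S y -> S (x + y).
Proof. by move=> [S0 SD] Sx Sy; rewrite -[x]scale1r; exact: SD. Qed.

Lemma linear_subspaceB S x y : linear_subspace S -> S x -> S y -> S (x - y).
Proof.
by move=> [S0 SD] Sx Sy; rewrite addrC -scaleN1r; exact: SD.
Qed.

Lemma closed_subspace_closure S : linear_subspace S -> closed_subspace (closure S).
Proof.
move=> linS; split; last exact: closed_closure.
split=> [|a x y]; first by apply: subset_closure; have [] := linS.
move=> /closure_seminorm_cvg[u Su ux] /closure_seminorm_cvg[w Sw wy].
apply: (@closed_seminorm_cvg _ (fun n => a *: u n + w n) _ (@closed_closure _ S)).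
  by move=> n; apply: subset_closure; apply linS.2.
rewrite /seminorm_cvg.
have c0 : (fun n => re_scalar `|a| * rnorm (u n - x) + rnorm (w n - y)) @ \oo --> (0 : R).
  rewrite -[X in _ --> X](addr0 0) -[X in _ --> X + _](mulr0 (re_scalar `|a|)).
  by apply: cvgD => //; apply: cvgMr.
apply: (@le_null _ _ _ 1 c0) => n; rewrite rnorm_ge0 mul1r -rnormZ.
by rewrite (le_trans _ (rnormD _ _))// scalerBr opprD addrACA.
Qed.

Lemma smallest_linear_subspace S : linear_subspace (smallest (@linear_subspace _ V) S).
Proof.
split=> [T [linT _]|a x y Sx Sy T TP]; first by have [] := linT.
by have [linT _] := TP; apply: linT.2; [exact: Sx | exact: Sy].
Qed.

Lemma closed_span_closed_subspace S : closed_subspace (closed_span S).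
Proof. exact/closed_subspace_closure/smallest_linear_subspace. Qed.

End Sequences.

Lemma rnorm_complete (V : completeNormedModType (scalar R k)) :
  seminorm_complete (@rnorm R k V).
Proof.
move=> u cu; have : cvg (u @ \oo).
  apply: cauchy_cvg; apply/cauchyP => e e0.
  have re0 : 0 < re_scalar e by rewrite -(@ltr_of_real) of_real0 re_scalarK ?ltW.
  have re20 : 0 < re_scalar e / 2 by rewrite divr_gt0.
  have [n0 n0P] := cu _ re20; exists (u n0); exists n0 => // n /= nn0.
  rewrite -(re_scalarK (ltW e0)); apply/ball_rnorm.
  rewrite (le_lt_trans (n0P _ _ nn0 (leqnn n0)))//.
  by rewrite gtr_pMr// invf_lt1// ltr1n.
move=> /cvg_ex[x ux]; exists x; apply/null_seqP => e e0.
have [|n0 _ n0P] := ux (ball x (of_real e)).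
  by apply: nbhsx_ballx; rewrite -of_real0 ltr_of_real.
exists n0 => n /n0P /= /ball_rnorm.
by rewrite ger0_norm ?rnorm_ge0// => /ltW.
Qed.

Lemma linear_rnorm_bound (V W : normedModType (scalar R k))
    (T : {linear V -> W}) : bounded_near T (nbhs (0 : V)) ->
  exists2 C, 0 < C & forall x, rnorm (T x) <= C * rnorm x.
Proof.
move=> /linear_boundedP/pinfty_ex_gt0[M M0 MP]; exists (re_scalar M) => [|x].
  by rewrite -(@ltr_of_real) of_real0 re_scalarK ?ltW.
by rewrite -(@ler_of_real _ k) of_realM !rnormE re_scalarK//; exact: ltW.
Qed.

End NormTopology.

(** * Cauchy-Schwarz, orthogonal projections and adjoints *)

Section HilbertGeometry.
Context {R : realType} {k : scalar_kind} {H : hilbertType R k}.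
Implicit Types (x y z f g h : H) (a : scalar R k) (S : set H).

Lemma re_innerNl x y : re_inner (- x) y = - re_inner x y.
Proof.
by apply/eqP; rewrite -addr_eq0 -re_innerDl addNr -(scale0r 0) -(@of_real0 R k)
  re_innerZl mul0r.
Qed.

Lemma rnormD_sqr x y :
  rnorm (x + y) ^+ 2 = rnorm x ^+ 2 + rnorm y ^+ 2 + 2 * re_inner x y.
Proof.
rewrite -!re_inner_rnorm re_innerDl !(re_innerC _ (x + y)) !re_innerDl.
by rewrite (re_innerC y x); ring.
Qed.

Lemma rnormB_sqr x y :
  rnorm (x - y) ^+ 2 = rnorm x ^+ 2 + rnorm y ^+ 2 - 2 * re_inner x y.
Proof.
rewrite rnormD_sqr (re_innerC x) re_innerNl (re_innerC y) mulrN.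
by rewrite (seminormN (rnorm_seminorm H)).
Qed.

Lemma re_innerDr x y z : re_inner x (y + z) = re_inner x y + re_inner x z.
Proof. by rewrite !(re_innerC x) re_innerDl. Qed.

Lemma re_innerNr x y : re_inner x (- y) = - re_inner x y.
Proof. by rewrite !(re_innerC x) re_innerNl. Qed.

(** Cauchy-Schwarz, from the square of the norm of
    [rnorm y ^+ 2 *: x - re_inner x y *: y]. *)
Lemma re_inner_le x y : re_inner x y <= rnorm x * rnorm y.
Proof.
have [y0|y0] := eqVneq (rnorm y) 0.
  rewrite y0 mulr0 (rnorm0_eq0 y0) re_innerC -(scale0r 0) -(@of_real0 R k).
  by rewrite re_innerZl mul0r.
have {}y0 : 0 < rnorm y by rewrite lt_neqAle eq_sym y0 rnorm_ge0.
pose c := re_inner x y.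
have := sqr_ge0 (rnorm (of_real (rnorm y ^+ 2) *: x - of_real c *: y)).
rewrite rnormB_sqr !(seminorm_realZ (rnorm_seminorm H)) re_innerZl.
rewrite (re_innerC _ (_ *: y)) re_innerZl (re_innerC y) -/c.
rewrite !exprMn !real_normK ?num_real// => h.
have {}h : 0 <= rnorm y ^+ 2 * ((rnorm x * rnorm y) ^+ 2 - c ^+ 2).
  by apply: le_trans h _; rewrite le_eqVlt; apply/orP; left; apply/eqP; ring.
move: h; rewrite pmulr_rge0 ?exprn_gt0// subr_ge0 => h.
apply: ler_normlW.
by rewrite -ler_sqr ?nnegrE ?mulr_ge0 ?rnorm_ge0// real_normK ?num_real.
Qed.

Lemma inner_eq0 x y : (forall a, re_inner x (a *: y) = 0) -> inner x y = 0.
Proof.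
by move=> /(_ (inner x y)); rewrite /re_inner innerZr => /re_scalar_eq0.
Qed.

End HilbertGeometry.

Section OrthogonalProjection.
Context {R : realType} {k : scalar_kind} {H : hilbertType R k}.
Implicit Types (f g w p : H) (S : set H).

(** The parallelogram law, applied to [f - u m] and [f - u n], makes every
    minimizing sequence Cauchy, the midpoint of [u m] and [u n] being in [S]. *)
Lemma nearest_point S f : closed_subspace S ->
  exists2 p, S p & forall w, S w -> rnorm (f - p) <= rnorm (f - w).
Proof.
move=> [linS closedS]; have NP := rnorm_seminorm H.
pose D : set R := [set rnorm (f - w) ^+ 2 | w in S]; pose d := inf D.
have lbD : has_lbound D by exists 0 => _ [w _ <-]; exact: sqr_ge0.
have infD : has_inf D by split=> //; exists (rnorm (f - 0) ^+ 2), 0 => //; exact: linS.1.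
have dS w : S w -> d <= rnorm (f - w) ^+ 2 by move=> Sw; apply: ge_inf => //; exists w.
have /choice[u uP] n : exists w, S w /\ rnorm (f - w) ^+ 2 <= d + harmonic n.
  have [_ [w Sw <-] /ltW wd] := inf_adherent (harmonic_gt0 n) infD.
  by exists w.
have Su n : S (u n) by have [] := uP n.
have ud n : rnorm (f - u n) ^+ 2 <= d + harmonic n by have [] := uP n.
have [p up] : exists p, seminorm_cvg (@rnorm R k H) u p.
  apply: rnorm_complete; apply: (@seminorm_cauchy_sqr _ _ _ _ _ (fun n => 2 * harmonic n)).
    by rewrite -[X in _ --> X](mulr0 2); apply: cvgMr; exact: cvg_harmonic.
  move=> m n; set a := f - u n; set b := f - u m.
  have -> : u m - u n = a - b by rewrite /a /b opprB [RHS]addrC addrA subrK.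
  have half : of_real 2^-1 *: (a + b) = f - of_real 2^-1 *: (u m + u n).
    rewrite /a /b addrACA -opprD (addrC (u n)) scalerBr; congr (_ - _).
    rewrite scalerDr -scalerDl -of_realD (_ : _ + _ = 1); last by field.
    by rewrite of_real1 scale1r.
  have /dS : S (of_real 2^-1 *: (u m + u n)).
    by apply: linear_subspaceZ => //; apply: linear_subspaceD.
  rewrite -half seminorm_realZ// exprMn real_normK ?num_real//.
  rewrite (rnormD_sqr a b) (rnormB_sqr a b).
  rewrite (_ : 2^-1 ^+ 2 = 4^-1); last by field.
  have := ud m; have := ud n; rewrite -/a -/b; lra.
exists p; first exact: (closed_seminorm_cvg closedS Su up).
move=> w Sw; rewrite -ler_sqr ?nnegrE ?rnorm_ge0//.
apply: le_trans (dS w Sw).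
have fup : (fun n => rnorm (f - u n)) @ \oo --> rnorm (f - p).
  apply: (@seminorm_cvg_norm _ _ _ _ (fun n => f - u n) (f - p)) => //.
  rewrite /seminorm_cvg; under eq_fun do rewrite opprB addrC addrA subrK seminormC//.
  exact: up.
have dn : (fun n => d + harmonic n) @ \oo --> d.
  by rewrite -[X in _ --> X](addr0 d); apply: cvgD; [exact: cvg_cst|exact: cvg_harmonic].
rewrite expr2.
apply: (ler_cvg_to (cvgM fup fup) dn); near=> n; rewrite /= -expr2; exact: ud.
Unshelve. all: by end_near. Qed.

(** At the nearest point [p] the distance to [p + t *: w] cannot decrease to
    first order in [t]. *)
Lemma orth_proj_exists S f : closed_subspace S ->
  exists p, S p /\ forall w, S w -> inner (f - p) w = 0.
Proof.
move=> closedS; have [linS _] := closedS.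
have [p Sp pmin] := nearest_point f closedS.
exists p; split=> // w Sw; apply: inner_eq0 => a.
have {Sw} : S (a *: w) by exact: linear_subspaceZ.
move: (a *: w) => {}w Sw {a}.
set c := re_inner (f - p) w; pose b := rnorm w ^+ 2.
have b1 : 0 < b + 1 by rewrite ltr_wpDl ?sqr_ge0.
(* The minimizer in t is c / b; the denominator b + 1 also serves when w = 0. *)
pose t := c / (b + 1).
have := pmin (p + of_real t *: w) (linear_subspaceD linS Sp (linear_subspaceZ _ linS Sw)).
rewrite -ler_sqr ?nnegrE ?rnorm_ge0// opprD addrA (rnormB_sqr (f - p)).
rewrite (seminorm_realZ (rnorm_seminorm H)) exprMn real_normK ?num_real//.
rewrite re_innerC re_innerZl (re_innerC w) -/c -/b.
rewrite -addrA lerDl => h.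
have e : (t ^+ 2 * b - 2 * (t * c)) * (b + 1) ^+ 2 = - (c ^+ 2 * (b + 2)).
  by rewrite /t; field; rewrite gt_eqF.
have : 0 <= - (c ^+ 2 * (b + 2)).
  by rewrite -e mulr_ge0 ?sqr_ge0.
rewrite oppr_ge0 pmulr_lle0; last by rewrite ltr_wpDl ?sqr_ge0.
move=> c0; have : c ^+ 2 == 0 by rewrite eq_le c0 sqr_ge0.
by rewrite sqrf_eq0 => /eqP.
Qed.

Section Projection.
Variables (S : set H) (closedS : closed_subspace S).

Lemma orth_projP f :
  S (orth_proj S f) /\ forall w, S w -> inner (f - orth_proj S f) w = 0.
Proof. exact: xgetPex (orth_proj_exists f closedS). Qed.

Lemma orth_proj_mem f : S (orth_proj S f). Proof. exact: (orth_projP f).1. Qed.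

Lemma inner_orth_projl f w : S w -> inner (orth_proj S f) w = inner f w.
Proof.
move=> Sw; apply/esym/eqP; rewrite -subr_eq0; apply/eqP.
by rewrite -[RHS]((orth_projP f).2 w Sw) linearBl.
Qed.

Lemma orth_proj_unique f p : S p -> (forall w, S w -> inner p w = inner f w) ->
  orth_proj S f = p.
Proof.
move=> Sp pf; apply/eqP; rewrite -subr_eq0; apply/eqP/rnorm0_eq0/eqP.
rewrite -sqrf_eq0 -re_inner_rnorm /re_inner; apply/eqP.
set q := orth_proj S f - p.
have Sq : S q by apply: linear_subspaceB (orth_proj_mem f) Sp; exact: closedS.1.
rewrite {1}/q linearBl/= inner_orth_projl// pf// subrr.
by rewrite -(@of_real0 R k) of_realK.
Qed.

Lemma orth_proj_linear : linear (orth_proj S).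
Proof.
move=> a f g; apply: orth_proj_unique => [|w Sw].
  by apply: closedS.1.2; exact: orth_proj_mem.
by rewrite !innerDl !innerZl !inner_orth_projl.
Qed.

Lemma orth_proj_self_adjoint f g : inner (orth_proj S f) g = inner f (orth_proj S g).
Proof.
rewrite -(inner_orth_projl f (orth_proj_mem g)) innerC [RHS]innerC.
by rewrite (inner_orth_projl g (orth_proj_mem f)).
Qed.

Lemma re_inner_orth_proj f : re_inner f (orth_proj S f) = rnorm (orth_proj S f) ^+ 2.
Proof.
by rewrite -re_inner_rnorm /re_inner (inner_orth_projl f (orth_proj_mem f)).
Qed.

Lemma rnorm_orth_proj f : rnorm (orth_proj S f) <= rnorm f.
Proof.
have := re_inner_le f (orth_proj S f); rewrite re_inner_orth_proj expr2.
have := rnorm_ge0 (orth_proj S f); rewrite le_eqVlt => /orP[/eqP <- _|p0].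
  exact: rnorm_ge0.
by rewrite ler_pM2r.
Qed.

End Projection.

End OrthogonalProjection.

Section Riesz.
Context {R : realType} {k : scalar_kind} {H G : hilbertType R k}.
Variables (T : {linear H -> G}) (boundedT : bounded_near T (nbhs (0 : H))).

Lemma closed_subspace_annihilated (g : G) :
  closed_subspace [set f | inner (T f) g = 0].
Proof.
split=> [|x /closure_seminorm_cvg[u uK ux]].
  split=> [|a x y xK yK] /=; first by rewrite linear0 linear0l.
  by rewrite linearP innerDl innerZl xK yK mulr0 addr0.
have [C C0 TC] := linear_rnorm_bound boundedT.
have le0 a : re_inner (T x) (a *: g) <= 0.
  apply: (ler_null_perturb (K := C * rnorm (a *: g)) ux) => n.
  rewrite add0r mulrAC -(seminormN (rnorm_seminorm H)) opprB.
  apply: (@le_trans _ _ (re_inner (T (x - u n)) (a *: g))).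
    have un0 : re_inner (T (u n)) (a *: g) = 0.
      by rewrite /re_inner innerZr uK mulr0 -(@of_real0 R k) of_realK.
    by rewrite linearB re_innerDl re_innerNl un0 subr0.
  by apply: le_trans (re_inner_le _ _) _; rewrite ler_wpM2r ?rnorm_ge0.
apply: inner_eq0 => a; apply/eqP; rewrite eq_le le0 /=.
by rewrite -oppr_le0 -re_innerNr -scaleNr.
Qed.

(** Riesz representation of the functional [inner (T f) g]: it is a multiple of
    the inner product with a vector [q] orthogonal to its kernel. *)
Lemma adjoint_exists (g : G) : exists h, forall f, inner (T f) g = inner f h.
Proof.
have closedK := closed_subspace_annihilated g.
set K := [set _ | _] in closedK.
have [TK|/existsNP[f0 f0K]] := pselect (forall f, inner (T f) g = 0).
  by exists 0 => f; rewrite TK linear0r.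
have [piK qK] := orth_projP closedK f0.
set q := f0 - orth_proj K f0 in qK.
have Tq : inner (T q) g != 0.
  by rewrite /q linearB linearBl /= [X in _ - X]piK subr0; apply/eqP.
have qq : inner q q != 0.
  apply: contra Tq => /eqP qq; suff -> : q = 0 by rewrite linear0 linear0l.
  apply/rnorm0_eq0/eqP; rewrite -sqrf_eq0 -re_inner_rnorm /re_inner qq.
  by rewrite -(@of_real0 R k) of_realK.
exists (conj_scalar (inner (T q) g / inner q q) *: q) => f.
rewrite innerZr conj_scalarK.
pose a := inner (T f) g / inner (T q) g.
have : inner (f - a *: q) q = 0.
  rewrite innerC qK; first by rewrite -(@of_real0 R k) conj_of_real.
  rewrite /K /= linearB linearZ linearBl/= innerZl /a.
  by rewrite divfK// subrr.
rewrite linearBl/= innerZl => /eqP; rewrite subr_eq0 => /eqP ->.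
rewrite /a; move: (inner _ g) (inner _ g) (inner q q) Tq qq => b c d c0 d0.
by rewrite [RHS]mulrC mulrA [_ * d * c]mulrAC divfK// mulfK.
Qed.

Lemma adjointP f g : inner (T f) g = inner f (adjoint T g).
Proof.
have : [set h | forall f, inner (T f) g = inner f h] (adjoint T g).
  exact: xgetPex (adjoint_exists g).
exact.
Qed.

End Riesz.

(** * Completeness of the Hilbert sum *)

Section DirectSumComplete.
Context {R : realType} {k : scalar_kind} {I : choiceType}.
Variable E : I -> hilbertType R k.
Implicit Types (f : forall i, E i) (u : l2sum E) (c : R).

Lemma sum_sqr_norm_leP f c : (sum_sqr_norm f <= c%:E)%E <->
  forall A : set I, finite_set A -> \sum_(i \in A) rnorm (f i) ^+ 2 <= c.
Proof.
split=> [fc A finA|fc].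
  rewrite -lee_fin -fsumEFin//; apply: le_trans fc.
  by apply: ereal_sup_ubound; exists A.
apply: ge_ereal_sup => _ [A [finA _] <-].
by rewrite fsumEFin// lee_fin; exact: fc.
Qed.

(** Fatou's lemma.  It makes the norm of the Hilbert sum lower semicontinuous
    for coordinatewise convergence. *)
Lemma sum_sqr_norm_fatou (F : nat -> forall i, E i) f c :
  (forall n, (sum_sqr_norm (F n) <= c%:E)%E) ->
  (forall i, seminorm_cvg (@rnorm R k (E i)) (fun n => F n i) (f i)) ->
  (sum_sqr_norm f <= c%:E)%E.
Proof.
move=> Fc Ff; apply/sum_sqr_norm_leP => A finA.
have cvgS (s : seq I) : (fun n => \sum_(i <- s) rnorm (F n i) ^+ 2) @ \oo -->
    \sum_(i <- s) rnorm (f i) ^+ 2.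
  elim: s => [|i s IH].
    by under eq_fun do rewrite big_nil; rewrite big_nil; exact: cvg_cst.
  under eq_fun do rewrite big_cons expr2; rewrite big_cons expr2.
  by apply: cvgD IH; apply: cvgM; apply: seminorm_cvg_norm (Ff i); exact: rnorm_seminorm.
rewrite fsbig_finite//=; apply: (cvgr_to_le (cvgS (fset_set A))); near=> n.
by have /sum_sqr_norm_leP/(_ A finA) := Fc n; rewrite fsbig_finite.
Unshelve. all: by end_near. Qed.

Lemma rnorm_l2E u : rnorm u = l2_rnorm u.
Proof. by rewrite /rnorm l2_normE of_realK. Qed.

Lemma rnorm_coord_le u i : rnorm (u i) <= rnorm u.
Proof.
rewrite rnorm_l2E -ler_sqr ?nnegrE ?rnorm_ge0 ?l2_rnorm_ge0// -lee_fin l2_rnorm_sqr.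
by apply: esum_ge; exists [set i]; [split=> //; exact: finite_set1|rewrite fsbig_set1].
Qed.

Lemma rnorm_l2_le u c : 0 <= c ->
  (sum_sqr_norm u <= (c ^+ 2)%:E)%E = (rnorm u <= c).
Proof.
move=> c0; rewrite -l2_rnorm_sqr -rnorm_l2E lee_fin.
by rewrite ler_sqr ?nnegrE ?rnorm_ge0.
Qed.

(** The coordinatewise limit [x] of a Cauchy sequence [u] is its limit in norm:
    for [n] large, Fatou's lemma applied to the sequence [u n - u m] in [m]
    bounds [u n - x]. *)
Lemma l2sum_complete : seminorm_complete (@rnorm R k (l2sum E)).
Proof.
move=> u cu.
have coord_cvg i : exists y : E i,
    seminorm_cvg (@rnorm R k (E i)) (fun n => u n i) y.
  apply: rnorm_complete => e /cu[n0 n0P]; exists n0 => m n m0 nn0.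
  apply: le_trans (n0P m n m0 nn0).
  apply: le_trans (rnorm_coord_le (u m - u n) i); rewrite /= scaleN1r//.
pose x i := projT1 (cid (coord_cvg i)); have ux i := projT2 (cid (coord_cvg i)).
have tail (e : R) : 0 < e -> exists n0, forall n, (n0 <= n)%N ->
    (sum_sqr_norm (fun i => u n i - x i)%R <= (e ^+ 2)%:E)%E.
  move=> e0; have [n0 n0P] := cu e e0; exists n0 => n nn0.
  apply: (@sum_sqr_norm_fatou (fun m i => (u n - u (n0 + m)%N) i)) => [m|i].
    by rewrite rnorm_l2_le ?(ltW e0)//; apply: n0P => //; rewrite leq_addr.
  have /null_seqP uxi := ux i; apply/null_seqP => d /uxi[n1 n1P].
  exists n1 => m nm; apply: le_trans (n1P (n0 + m)%N _); last first.
    by rewrite (leq_trans nm)// leq_addl.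
  rewrite /= scaleN1r !ger0_norm ?rnorm_ge0//.
  rewrite (seminormC (rnorm_seminorm (E i)) (u (n0 + m)%N i)).
  by rewrite opprB addrC addrA subrK.
have sx : square_summable x.
  have [n0 /(_ n0 (leqnn n0)) h] := tail 1 ltr01.
  have s1 : square_summable (fun i => u n0 i - x i) by exact: le_lt_trans h (ltry _).
  have := square_summableD (l2funP (u n0)) (square_summableZ (-1) s1).
  suff -> : (fun i => u n0 i + -1 *: (u n0 i - x i)) = x by [].
  by apply: functional_extensionality_dep => i; rewrite scaleN1r opprB addrC subrK.
exists (L2sum sx); apply/null_seqP => e e0; have [n0 n0P] := tail e e0.
exists n0 => n /n0P; rewrite ger0_norm ?rnorm_ge0// -rnorm_l2_le ?(ltW e0)//.
suff -> : (fun i => u n i - x i) = (u n - L2sum sx) by [].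
by apply: functional_extensionality_dep => i; rewrite /= scaleN1r.
Qed.

End DirectSumComplete.

(** * The analysis operator *)

Section AnalysisOperator.
Context {R : realType} {k : scalar_kind} {H : hilbertType R k}.
Context {I : choiceType} {E : I -> hilbertType R k}.
Variables (W : I -> set H) (Lambda : forall i, {linear H -> E i}) (v : I -> R).
Hypothesis closedW : forall i, closed_subspace (W i).
Hypothesis boundedL : forall i, bounded_near (Lambda i) (nbhs (0 : H)).
Hypothesis v_gt0 : forall i, 0 < v i.

Local Notation T := (analysis W Lambda v).
Local Notation M := (gfusion_span W Lambda).
Local Notation proj_M := (orth_proj M).

Lemma analysis_linear i : linear (fun f => T f i).
Proof.
move=> a f g; rewrite /analysis orth_proj_linear// linearP scalerDr !scalerA.
by rewrite (mulrC a).
Qed.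

Lemma analysisD f g i : T (f + g) i = T f i + T g i.
Proof. by have := analysis_linear i 1 f g; rewrite !scale1r. Qed.

Lemma analysis0 i : T 0 i = 0.
Proof. by apply: (@addrI _ (T 0 i)); rewrite -analysisD !addr0. Qed.

Lemma analysisZ a f i : T (a *: f) i = a *: T f i.
Proof.
by have := analysis_linear i a f 0; rewrite analysis0 !addr0.
Qed.

Lemma analysisB f g i : T (f - g) i = T f i - T g i.
Proof. by rewrite analysisD -scaleN1r analysisZ scaleN1r. Qed.

Lemma sum_sqr_norm_analysis f : sum_sqr_norm (T f) =
  (\esum_(i in [set: I])
     (v i ^+ 2 * rnorm (Lambda i (orth_proj (W i) f)) ^+ 2)%:E)%E.
Proof.
apply: eq_esum => i _; rewrite /analysis (seminorm_realZ (rnorm_seminorm _)).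
by rewrite exprMn real_normK ?num_real.
Qed.

Lemma analysis_coord_bounded i :
  exists2 C, 0 < C & forall f, rnorm (T f i) <= C * rnorm f.
Proof.
have [C C0 CP] := linear_rnorm_bound (boundedL i).
exists (v i * C) => [|f]; first exact: mulr_gt0.
rewrite /analysis (seminorm_realZ (rnorm_seminorm _)) gtr0_norm// -mulrA.
rewrite ler_pM2l// (le_trans (CP _))// ler_pM2l//.
exact: rnorm_orth_proj.
Qed.

Lemma analysis_coord_cvg i (u : nat -> H) f : seminorm_cvg (@rnorm R k H) u f ->
  seminorm_cvg (@rnorm R k (E i)) (fun n => T (u n) i) (T f i).
Proof.
have [C C0 CP] := analysis_coord_bounded i.
by move=> uf; apply: (le_null (K := C) uf) => n; rewrite rnorm_ge0 -analysisB CP.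
Qed.

Lemma inner_analysis i f (g : E i) : inner (T f i) g =
  of_real (v i) * inner f (orth_proj (W i) (adjoint (Lambda i) g)).
Proof. by rewrite innerZl adjointP// orth_proj_self_adjoint. Qed.

Lemma gfusion_span_closed : closed_subspace M.
Proof. exact: closed_span_closed_subspace. Qed.

Lemma gfusion_span_generator i (g : E i) :
  M (orth_proj (W i) (adjoint (Lambda i) g)).
Proof.
apply: subset_closure; apply: sub_gen_smallest.
by exists i => //; exists g.
Qed.

(** The difference [q = f - proj_M f] is orthogonal to the generators
    [orth_proj (W i) (adjoint (Lambda i) g)] of [M]; the one given by
    [g = T q i] shows that [T q i] has norm zero. *)
Lemma analysis_orth_proj f i : T (proj_M f) i = T f i.
Proof.
apply/eqP; rewrite eq_sym -subr_eq0 -analysisB; apply/eqP.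
apply/rnorm0_eq0/eqP; rewrite -sqrf_eq0 -re_inner_rnorm /re_inner inner_analysis.
rewrite (orth_projP gfusion_span_closed f).2; last exact: gfusion_span_generator.
by rewrite mulr0 -(@of_real0 R k) of_realK.
Qed.

(** ** Frame bounds give a closed range *)

Section FromFrame.
Variables (A B : R) (A0 : 0 < A).
Hypothesis lower : forall f, M f -> ((A * rnorm f ^+ 2)%:E <= sum_sqr_norm (T f))%E.
Hypothesis upper : forall f, M f -> (sum_sqr_norm (T f) <= (B * rnorm f ^+ 2)%:E)%E.

Lemma frame_square_summable f : square_summable (T f).
Proof.
suff -> : T f = T (proj_M f).
  apply: le_lt_trans (ltry _); apply: upper.
  exact: orth_proj_mem gfusion_span_closed _.
by apply: functional_extensionality_dep => i; rewrite analysis_orth_proj.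
Qed.

(** If [T (f n)] converges to [y] with [f n] in [M], the lower frame bound makes
    [f] a Cauchy sequence, and [y] is the image of its limit. *)
Lemma frame_closed_range : closed (analysis_range W Lambda v).
Proof.
move=> y /closure_seminorm_cvg[u uT uy].
have /choice[f fP] n : exists f, l2fun (u n) = T f /\ M f.
  have [f uf] := uT n; exists (proj_M f); split.
    by rewrite uf; apply: functional_extensionality_dep => i; rewrite analysis_orth_proj.
  exact: orth_proj_mem gfusion_span_closed _.
have uf n i : u n i = T (f n) i by have [-> _] := fP n.
pose w n := 2 / A * rnorm (u n - y) ^+ 2.
have w0 : w @ \oo --> 0.
  rewrite -[X in _ --> X](mulr0 (2 / A)); apply: cvgMr.
  rewrite -[X in _ --> X](mulr0 0).
  by under eq_fun do rewrite expr2; apply: cvgM.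
have [g fg] : exists g, seminorm_cvg (@rnorm R k H) f g.
  apply: rnorm_complete; apply: (seminorm_cauchy_sqr w0) => m n.
  have : A * rnorm (f m - f n) ^+ 2 <= rnorm (u m - u n) ^+ 2.
    rewrite -lee_fin rnorm_l2E l2_rnorm_sqr.
    have -> : sum_sqr_norm (u m - u n) = sum_sqr_norm (T (f m - f n)).
      by apply: eq_esum => i _; rewrite /= scaleN1r !uf analysisB.
    apply: lower; apply: linear_subspaceB (fP m).2 (fP n).2.
    exact: gfusion_span_closed.1.
  have := seminorm_triangle (rnorm_seminorm _) (u m) y (u n).
  rewrite (seminormC (rnorm_seminorm _) y); rewrite /w.
  have := rnorm_ge0 (u m - u n).
  move: (rnorm (u m - u n)) (rnorm (u m - y)) (rnorm (u n - y)) => c a b.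
  move=> c0 cab Adc; rewrite -mulrDr mulrAC ler_pdivlMr// mulrC (le_trans Adc)//.
  have := sqr_ge0 (a - b); have := ler_pM c0 c0 cab cab; rewrite !expr2; lra.
exists g; apply: functional_extensionality_dep => i; apply/eqP.
rewrite -subr_eq0; apply/eqP/rnorm0_eq0/eqP; rewrite eq_le rnorm_ge0 andbT.
have c0 : (fun n => rnorm (u n - y) + rnorm (T (f n) i - T g i)) @ \oo --> (0 : R).
  by rewrite -[X in _ --> X](addr0 0); apply: cvgD => //; exact: analysis_coord_cvg.
apply: (ler_null_perturb (K := 1) c0) => n; rewrite add0r mul1r.
have := rnorm_coord_le (u n - y) i; rewrite /= scaleN1r uf.
rewrite (seminormC (rnorm_seminorm (E i))) => h.
apply: le_trans (seminorm_triangle (rnorm_seminorm (E i)) _ (T (f n) i) _) _.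
by rewrite lerD2r.
Qed.

End FromFrame.

(** ** A closed range gives frame bounds *)

Section FromClosedRange.
Hypothesis summable : forall f, square_summable (T f).

Definition analysis_l2 f : l2sum E := L2sum (summable f).

Lemma analysis_l2D f g : analysis_l2 (f + g) = analysis_l2 f + analysis_l2 g.
Proof. by apply: l2sumP => i; exact: analysisD. Qed.

Lemma analysis_l2Z a f : analysis_l2 (a *: f) = a *: analysis_l2 f.
Proof. by apply: l2sumP => i; exact: analysisZ. Qed.

Definition analysis_norm f : R := rnorm (analysis_l2 f).

Lemma analysis_norm_seminorm : seminorm analysis_norm.
Proof.
rewrite /analysis_norm; split=> [f g|a f].
  by rewrite analysis_l2D rnormD.
by rewrite analysis_l2Z rnormZ.
Qed.

Lemma analysis_norm_sqr f : ((analysis_norm f ^+ 2)%:E = sum_sqr_norm (T f))%E.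
Proof. by rewrite /analysis_norm rnorm_l2E l2_rnorm_sqr. Qed.

(** The upper bound: by Fatou's lemma [analysis_norm] is lower semicontinuous
    for the norm of [H]. *)
Lemma analysis_bounded : exists2 C, 0 < C & forall f, analysis_norm f <= C * rnorm f.
Proof.
apply: lsc_seminorm_dominated.
- exact: rnorm_seminorm.
- exact: analysis_norm_seminorm.
- exact: rnorm_complete.
move=> u f c uc uf.
have c0 : 0 <= c := le_trans (rnorm_ge0 _) (uc 0%N).
rewrite /analysis_norm -rnorm_l2_le//.
apply: (@sum_sqr_norm_fatou _ _ _ _ (fun n => analysis_l2 (u n))) => [n|i].
  by rewrite rnorm_l2_le//; exact: uc.
exact: analysis_coord_cvg.
Qed.

(** This is where the range has to be closed: the limit in the Hilbert sum of
    the images of an [analysis_norm]-Cauchy sequence is again an image. *)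
Lemma analysis_norm_complete : closed (analysis_range W Lambda v) ->
  seminorm_complete analysis_norm.
Proof.
move=> closedT u cu.
have l2B f g : analysis_norm (f - g) = rnorm (analysis_l2 f - analysis_l2 g).
  by rewrite /analysis_norm analysis_l2D -scaleN1r analysis_l2Z scaleN1r.
have [y uy] : exists y, seminorm_cvg (@rnorm R k (l2sum E)) (analysis_l2 \o u) y.
  apply: l2sum_complete => e /cu[n0 n0P]; exists n0 => m n m0 nn0.
  by rewrite /= -l2B; exact: n0P.
have [|f yf] := closed_seminorm_cvg closedT _ uy.
  by move=> n; exists (u n).
exists f; rewrite /seminorm_cvg; under eq_fun do rewrite l2B.
suff <- : y = analysis_l2 f by [].
by apply: l2sumP => i; rewrite yf.
Qed.

(** Continuity of the functional [re_inner _ y] for [analysis_norm]. *)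
Definition analysis_dominated (y : H) : Prop :=
  exists C, forall f, re_inner f y <= C * analysis_norm f.

(** The inner product with a generator of [M] is a coordinate of [T] up to the
    factor [v i], hence continuous for [analysis_norm]. *)
Lemma analysis_dominated_span y : smallest (@linear_subspace _ H)
    (\bigcup_i range (fun g : E i => orth_proj (W i) (adjoint (Lambda i) g))) y ->
  analysis_dominated y.
Proof.
have NP := analysis_norm_seminorm.
apply; split; first split.
- by exists 0 => f; rewrite mul0r /re_inner linear0r -(@of_real0 R k) of_realK.
- move=> a x z [C CP] [D DP]; exists (re_scalar `|conj_scalar a| * C + D) => f.
  rewrite re_innerDr mulrDl lerD//.
  have -> : re_inner f (a *: x) = re_inner (conj_scalar a *: f) x.
    by rewrite /re_inner innerZr innerZl.
  apply: le_trans (CP _) _; rewrite (seminormZ NP).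
  by rewrite le_eqVlt; apply/orP; left; apply/eqP; ring.
- move=> _ [i _ [g _ <-]]; exists (rnorm g / v i) => f.
  rewrite mulrAC ler_pdivlMr// mulrC.
  have -> : v i * re_inner f (orth_proj (W i) (adjoint (Lambda i) g)) = re_inner (T f i) g.
    by rewrite /re_inner inner_analysis re_scalarMr.
  apply: le_trans (re_inner_le _ _) _; rewrite mulrC ler_wpM2l ?rnorm_ge0//.
  exact: (rnorm_coord_le (analysis_l2 f) i).
Qed.

(** [rnorm (proj_M f)] is the least [c] with [re_inner f y <= c * rnorm y] for
    all [y] in the span, which is dense in [M], and each [re_inner _ y] is
    continuous for [analysis_norm]. *)
Lemma orth_proj_lsc :
  seq_lower_semicontinuous analysis_norm (fun f => rnorm (proj_M f)).
Proof.
move=> u f c uc uf; have closedM := gfusion_span_closed.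
have c0 : 0 <= c := le_trans (rnorm_ge0 _) (uc 0%N).
have span_le y : smallest (@linear_subspace _ H)
    (\bigcup_i range (fun g : E i => orth_proj (W i) (adjoint (Lambda i) g))) y ->
    re_inner f y <= c * rnorm y.
  move=> Sy; have [C CP] := analysis_dominated_span Sy.
  apply: (ler_null_perturb (K := C) uf) => n.
  rewrite (seminormC analysis_norm_seminorm) -{1}(subrK (u n) f) re_innerDl.
  rewrite addrC lerD//.
  have -> : re_inner (u n) y = re_inner (proj_M (u n)) y.
    by rewrite /re_inner (inner_orth_projl closedM)//; exact: subset_closure.
  by apply: le_trans (re_inner_le _ _) _; rewrite ler_wpM2r ?rnorm_ge0.
have M_le y : M y -> re_inner f y <= c * rnorm y.
  move=> /closure_seminorm_cvg[z zS zy].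
  apply: (ler_null_perturb (K := c + rnorm f) zy) => n.
  have := span_le _ (zS n); have := re_inner_le f (y - z n).
  have := ler_wpM2l c0 (rnormD (z n - y) y).
  rewrite re_innerDr re_innerNr subrK (seminormC (rnorm_seminorm H) y); lra.
have := M_le _ (orth_proj_mem closedM f).
rewrite re_inner_orth_proj// expr2.
have /orP[/eqP <- _|p0] : (0 == rnorm (proj_M f)) || (0 < rnorm (proj_M f)).
  by rewrite -le_eqVlt rnorm_ge0.
  exact: c0.
by rewrite ler_pM2r.
Qed.

(** The lower bound, in place of the open mapping theorem: [lsc_seminorm_dominated]
    on the space [H] seminormed by [analysis_norm]. *)
Lemma analysis_bounded_below : closed (analysis_range W Lambda v) ->
  exists2 C, 0 < C & forall f, M f -> rnorm f <= C * analysis_norm f.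
Proof.
move=> closedT; have closedM := gfusion_span_closed.
have [||||C C0 CP] := @lsc_seminorm_dominated R k H analysis_norm (fun f => rnorm (proj_M f)).
- exact: analysis_norm_seminorm.
- split=> [f g|a f].
    by rewrite -{1}(scale1r f) orth_proj_linear// scale1r rnormD.
  have p0 : proj_M 0 = 0.
    apply: (@addrI _ (proj_M 0)).
    by have := orth_proj_linear closedM 1 0 0; rewrite !scale1r !addr0 => /esym.
  by rewrite -[a *: f]addr0 orth_proj_linear// p0 addr0 rnormZ.
- exact: analysis_norm_complete.
- exact: orth_proj_lsc.
by exists C => // f Mf; have := CP f; rewrite (orth_proj_unique closedM Mf).
Qed.

Lemma closed_range_frame : closed (analysis_range W Lambda v) ->
  gfusion_frame_sequence W Lambda v.
Proof.
move=> closedT.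
have [C C0 CP] := analysis_bounded_below closedT.
have [D D0 DP] := analysis_bounded.
have C20 : 0 < C ^+ 2 by rewrite exprn_gt0.
exists (C ^+ 2)^-1, (Num.max (C ^+ 2)^-1 (D ^+ 2)); split=> [||f Mf].
- by rewrite invr_gt0.
- by rewrite le_max lexx.
have N0 : 0 <= analysis_norm f by exact: rnorm_ge0.
rewrite -sum_sqr_norm_analysis -analysis_norm_sqr !lee_fin; apply/andP; split.
  rewrite ler_pdivrMl// -exprMn ler_sqr ?nnegrE ?rnorm_ge0 ?mulr_ge0 ?(ltW C0)//.
  exact: CP.
apply: (@le_trans _ _ (D ^+ 2 * rnorm f ^+ 2)).
  by rewrite -exprMn ler_sqr ?nnegrE ?mulr_ge0 ?rnorm_ge0 ?(ltW D0).
by rewrite ler_wpM2r ?sqr_ge0// le_max lexx orbT.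
Qed.

End FromClosedRange.

Lemma analysis_range_subspace : linear_subspace (analysis_range W Lambda v).
Proof.
split=> [|a x y [f xf] [g yg]].
  exists 0; apply: functional_extensionality_dep => i.
  by rewrite analysis0.
exists (a *: f + g); apply: functional_extensionality_dep => i.
by rewrite analysisD analysisZ -xf -yg.
Qed.

End AnalysisOperator.

Theorem theorem4p4 (R : realType) (k : scalar_kind) (H : hilbertType R k)
    (J : set int) (E : J -> hilbertType R k)
    (W : J -> set H) (Lambda : forall j : J, {linear H -> E j}) (v : J -> R)
    (sepH : separable_space H)
    (closedW : forall j, closed_subspace (W j))
    (boundedL : forall j, bounded_near (Lambda j) (nbhs (0 : H)))
    (v_gt0 : forall j, 0 < v j) :
  gfusion_frame_sequence W Lambda v <->
  (forall f, square_summable (analysis W Lambda v f)) /\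
  closed_subspace (analysis_range W Lambda v).
Proof.
split=> [[A [B [A0 _ frameT]]]|[summable [_ closedT]]]; last first.
  exact: closed_range_frame.
have lower f : gfusion_span W Lambda f ->
    ((A * rnorm f ^+ 2)%:E <= sum_sqr_norm (analysis W Lambda v f))%E.
  by move=> /frameT/andP[+ _]; rewrite sum_sqr_norm_analysis.
have upper f : gfusion_span W Lambda f ->
    (sum_sqr_norm (analysis W Lambda v f) <= (B * rnorm f ^+ 2)%:E)%E.
  by move=> /frameT/andP[_ +]; rewrite sum_sqr_norm_analysis.
split; first exact: frame_square_summable upper.
split; first exact: analysis_range_subspace.
exact: frame_closed_range lower.
Qed.
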